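(* Let $k$ be an algebraically closed field of characteristic zero, let $r\geq 1$ and $n_1,\ldots,n_r\geq 1$ be integers, and let \[S=k[x_{1,1},\ldots,x_{1,n_1},\ldots\ldots,x_{r,1},\ldots,x_{r,n_r}]\] be the polynomial ring in $n_1+\ldots+n_r$ distinct variables $x_{i,j}$ ($1\le i\le r$, $1\le j\le n_i$). Consider the degree $d$ form \[F=M_1+\ldots+M_r,\qquad M_i=x_{i,1}^{a_{i,1}}\cdot\ldots\cdot x_{i,n_i}^{a_{i,n_i}}\quad (1\leq i\leq r),\] where the $a_{i,j}$ are integers with \[a_{i,1}+\ldots+a_{i,n_i}=d,\qquad 1\leq a_{i,1}\leq\ldots\leq a_{i,n_i}\qquad (1\leq i\leq r).\] If $d=1$, then $\mathrm{rk}(F)=1$. If $d\geq 2$, then \[\mathrm{rk}(F)=\sum_{i=1}^r \mathrm{rk}(M_i).\]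
   Context: For a homogeneous polynomial (form) $F$ of degree $d$ in a polynomial ring $S$ over $k$, the Waring rank $\mathrm{rk}(F)$ is the least integer $s$ for which there exist linear forms $L_1,\ldots,L_s\in S$ such that $F=\sum_{i=1}^s L_i^d$. *)

(* Defs.v *)
From mathcomp Require Import all_boot all_order all_algebra.
From mathcomp Require Import mpoly.
From Stdlib Require Import ClassicalEpsilon.

Set Implicit Arguments.
Unset Strict Implicit.
Unset Printing Implicit Defensive.

Import GRing.Theory.
Local Open Scope ring_scope.

Definition sum_of_powers (k : fieldType) (N d : nat) (F : {mpoly k[N]})
    (s : nat) : Prop :=
  exists L : 'I_s -> {mpoly k[N]},
    (forall i, L i \is 1.-homog) /\ F = \sum_(i < s) L i ^+ d.

Definition is_waring_rank (k : fieldType) (N d : nat) (F : {mpoly k[N]})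
    (s : nat) : Prop :=
  sum_of_powers d F s /\ forall t, sum_of_powers d F t -> (s <= t)%N.

(* The degree d is explicit because the zero form has every degree.  The value
   is meaningful only when some decomposition exists; waring_rankP shows that
   this is so for every form of positive degree over an algebraically closed
   field of characteristic zero. *)
Definition waring_rank (k : fieldType) (N d : nat) (F : {mpoly k[N]}) : nat :=
  epsilon (inhabits 0%N) (is_waring_rank d F).

(* tagnat.Rank enumerates the pairs (i, j) with j < n i bijectively by the
   ordinals below \sum_i n i. *)
Definition blockX (k : fieldType) (r : nat) (n : 'I_r -> nat) (i : 'I_r)
    (j : 'I_(n i)) : {mpoly k[\sum_(i < r) n i]} :=
  'X_(tagnat.Rank i j).

Definition block_monomial (k : fieldType) (r : nat) (n : 'I_r -> nat)
    (a : forall i : 'I_r, 'I_(n i) -> nat) (i : 'I_r) :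
    {mpoly k[\sum_(i < r) n i]} :=
  \prod_(j < n i) blockX k j ^+ a i j.

Section WaringRankExists.
Variables (k : closedFieldType) (N d : nat).
Hypotheses (char0 : [pchar k] =i pred0) (d_gt0 : (0 < d)%N).

Let W (F : {mpoly k[N]}) := exists s, sum_of_powers d F s.

Let natr_neq0 m : (0 < m)%N -> m%:R != 0 :> k.
Proof. by move=> m0; rewrite (pcharf0P k).1 // -lt0n. Qed.

Let W0 : W 0.
Proof. by exists 0%N, (fun=> 0); split=> [i|]; rewrite ?dhomog0 ?big_ord0. Qed.

Let WD F G : W F -> W G -> W (F + G).
Proof.
move=> [s [L [hL ->]]] [t [M [hM ->]]]; exists (s + t)%N.
exists (fun i => match split i with inl j => L j | inr j => M j end).
split=> [i|]; first by case: split.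
rewrite big_split_ord /=; congr (_ + _); apply: eq_bigr => i _.
  by rewrite (unsplitK (inl i)).
by rewrite (unsplitK (inr i)).
Qed.

Let WZ c F : W F -> W (c *: F).
Proof.
move=> [s [L [hL ->]]].
have [b bc] : exists b : k, b ^+ d = c.
  have [|b] := @closed_rootP k ('X^d - c%:P) _; last first.
    by rewrite rootE !hornerE subr_eq0 => /eqP; exists b.
  by rewrite size_XnsubC // eqSS -lt0n.
exists s, (fun i => b *: L i); split=> [i|]; first exact: dhomogZ.
by rewrite scaler_sumr; apply: eq_bigr => i _; rewrite exprZn bc.
Qed.

Let W_sum (I : eqType) (r : seq I) (F : I -> {mpoly k[N]}) :
  (forall i, i \in r -> W (F i)) -> W (\sum_(i <- r) F i).
Proof. by move=> h; rewrite big_seq; apply: (big_ind W). Qed.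

Let W_coef m (c : nat -> {mpoly k[N]}) :
    (forall t : k, W (\sum_(i < m) t ^+ i *: c i)) ->
  forall i, (i < m)%N -> W (c i).
Proof.
elim: m c => // m IH c hW.
have hlow i : (i < m)%N -> W (c i).
  move=> im; pose b j : k := 2 ^+ j - 2 ^+ m.
  have b_neq0 : b i != 0.
    rewrite /b -!natrX -opprB oppr_eq0 -natrB ?leq_exp2l ?(ltnW im) //.
    by apply: natr_neq0; rewrite subn_gt0 ltn_exp2l.
  suff : W (b i *: c i).
    by move/(WZ (b i)^-1); rewrite scalerA mulVf // scale1r.
  apply: (IH (fun j => b j *: c j)) => // t.
  have := WD (hW (2 * t)) (WZ (- 2 ^+ m) (hW t)).
  rewrite !big_ord_recr /= scalerDr scaler_sumr addrACA -big_split /=.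
  rewrite !scalerA exprMn mulNr scaleNr subrr addr0.
  congr W; apply: eq_bigr => j _; rewrite !scalerA -scalerDl /b exprMn.
  by rewrite -mulrDl mulrC.
move=> i; rewrite ltnS leq_eqVlt => /predU1P[->|]; last exact: hlow.
have hs : W (- 1 *: \sum_(i < m) c i).
  by apply/WZ/W_sum => j _; apply: hlow.
have := WD (hW 1) hs; rewrite big_ord_recr /= expr1n scale1r scaleN1r.
rewrite addrAC (eq_bigr (fun i : 'I_m => c i)) ?subrr ?add0r // => j _.
by rewrite expr1n scale1r.
Qed.

Let W_prod (s : seq {mpoly k[N]}) :
    (forall l, l \in s -> l \is 1.-homog) -> (size s <= d)%N ->
  forall L, L \is 1.-homog -> W (L ^+ (d - size s) * \prod_(l <- s) l).
Proof.
elim: s => [|l s IH] hs sd L hL.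
  exists 1%N, (fun=> L); split=> //.
  by rewrite big_nil mulr1 subn0 big_ord1.
have {}IH := IH (fun x xs => hs x (@mem_behead _ (l :: s) x xs)) (ltnW sd).
set e := (d - size s)%N in IH; rewrite /= in sd.
have e0 : (0 < e)%N by rewrite subn_gt0.
pose c i := ((L ^+ (e - i) * l ^+ i) *+ 'C(e, i)) * \prod_(l <- s) l.
have /W_coef/(_ 1%N) : forall t : k, W (\sum_(i < e.+1) t ^+ i *: c i).
  move=> t; have hl : l \is 1.-homog by apply: hs; rewrite mem_head.
  have := IH _ (dhomogD hL (dhomogZ t hl)); rewrite exprDn mulr_suml.
  congr W; apply: eq_bigr => i _; rewrite /c exprZn -scalerAr.
  by rewrite scalerMnr -scalerAl.
rewrite ltnS => /(_ e0); rewrite /c bin1 expr1 big_cons /= (subnS d) -/e subn1.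
rewrite mulrnAl -scaler_nat mulrA => /(WZ e%:R^-1).
by rewrite scalerA mulVf ?natr_neq0 // scale1r.
Qed.

Let W_monomial (m : 'X_{1..N}) : mdeg m = d -> W 'X_[m].
Proof.
move=> md.
have [s [hs ss ->]] : exists s : seq {mpoly k[N]},
    [/\ forall l, l \in s -> l \is 1.-homog, size s = d
      & 'X_[m] = \prod_(l <- s) l].
  rewrite -md mdegE mpolyXE_id.
  elim/big_rec2: _ => [|i p e _ [s [hs <- ->]]].
    by exists [::]; rewrite big_nil.
  exists (nseq (m i) 'X_i ++ s); split=> [l||].
  - rewrite mem_cat mem_nseq => /orP[/andP[_ /eqP ->]|/hs //].
    by rewrite dhomogX; apply/eqP; exact: mdeg1.
  - by rewrite size_cat size_nseq.
  - by rewrite big_cat /= big_nseq iter_mulr_1.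
have := W_prod hs; rewrite ss => /(_ (leqnn d) 0 (dhomog0 _ _ _)).
by rewrite subnn expr0 mul1r.
Qed.

Lemma waring_rankP (F : {mpoly k[N]}) :
  F \is d.-homog -> is_waring_rank d F (waring_rank d F).
Proof.
move=> hF; apply: epsilon_spec.
have [s0] : W F.
  rewrite (mpolyE F); apply: W_sum => m mF; apply: WZ.
  by apply/W_monomial/(dhomog_mf hF).
elim/ltn_ind: s0 => s0 IH s0P.
have [[t [ts tP]]|nt] :=
  classic (exists t, (t < s0)%N /\ sum_of_powers d F t); first exact: IH ts tP.
exists s0; split=> // t tP; rewrite leqNgt; apply/negP => ts.
by apply: nt; exists t.
Qed.

End WaringRankExists.

(* Main.v *)
Require Import Defs.
From mathcomp Require Import all_boot all_order all_algebra.
From mathcomp Require Import cyclic separable cyclotomic.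
From mathcomp Require Import mpoly zify.

Set Implicit Arguments.
Unset Strict Implicit.
Unset Printing Implicit Defensive.

Import GRing.Theory.
Local Open Scope ring_scope.

(** The common value of both sides is the sum over the blocks of
    R_i = \prod_(j >= 2) (a_{i,j} + 1), the product running over the
    variables of M_i other than the one of least exponent, x_{i,1}; it is
    called [monomial_rank] below.  Concatenating decompositions of the M_i
    gives rk F <= \sum_i rk M_i, so it suffices to prove rk M_i <= R_i
    ([sum_of_powers_monomial]) and \sum_i R_i <= rk F
    ([sum_monomial_rank_le]).

    Both inequalities compare coefficients in a power of a linear form L:
    by [mcoeff_linear_exp], up to multinomial coefficients, which are nonzero
    in characteristic 0, the coefficient of a monomial m of degree d in L^d is
    the value of m at the coefficient vector of L.

    Upper bound.  Let the L_z be the forms x_{i,1} + \sum_j z_j x_{i,j}, where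
    z_j runs over the roots of unity of order a_{i,j} + 1, for j >= 2.  The sum
    of (\prod_j z_j) L_z^d over these R_i tuples only retains the monomials of
    degree d in which the exponent of x_{i,j} is congruent to a_{i,j} modulo
    a_{i,j} + 1 for all j >= 2.  As a_{i,1} is the least exponent, the next
    larger value 2 a_{i,j} + 1 of an exponent would overshoot the degree, so
    only M_i remains.

    Lower bound.  Let F = L_1^d + ... + L_s^d and let P_1, ..., P_s be the
    coefficient vectors.  The functional m |-> \sum_p m(P_p) on monomials of
    degree d is nonzero exactly at the M_i.  It suffices to exhibit
    \sum_i R_i linearly independent functions on the points.  Choose a
    combination t of the x_{i,1} that vanishes at a point only if all x_{i,1}
    vanish there.  To each i and each monomial u dividing M_i and free of
    x_{i,1} attach the function u / t^(deg u - 1), extended by 0 to the zeros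
    of t, with u replaced by x_{i,1} when u = 1.  Pairing it against
    (M_i' / w) t^(deg w - 1) yields the functional at
    (M_i' / w) u t^(deg w - deg u) whenever deg u <= deg w; here w belongs to
    the block i', and again x_{i',1} stands for w = 1.  The value is nonzero
    for u = w and zero for all other u.  If deg u < deg w, then deg w >= 2, so
    M_i' / w contains the full power of x_{i',1} and another factor t leads
    outside all the M_i.  If deg u = deg w, then (M_i' / w) u can only be one
    of the M_i when it is M_i', that is when u = w, because M_i' / w is not
    constant; for deg w = 1 this is where d >= 2 is needed.  The pairing is
    thus triangular for the degree, whence the independence
    ([leq_card_triangular]). *)

(** * Powers of linear forms *)

Section LinearPowers.
Variables (R : comNzRingType) (N : nat).
Implicit Types (p L : {mpoly R[N]}) (m : 'X_{1..N}).

Lemma mderivX_exp v p e :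
  (p ^+ e.+1)^`M(v) = (p^`M(v) * p ^+ e) *+ e.+1.
Proof.
elim: e => [|e IH]; first by rewrite expr1 expr0 mulr1 mulr1n.
by rewrite exprS mderivM IH mulrnAr mulrCA -exprS [in RHS]mulrS.
Qed.

Lemma mderiv_linear L v : L \is 1.-homog -> L^`M(v) = (L@_U_(v))%:MP.
Proof.
move=> hL; apply/mpolyP => m; rewrite mcoeff_deriv mcoeffC.
have [->|m0] := eqVneq m 0%MM; first by rewrite mnm0E add0m mulr1.
rewrite (dhomog_nemf_coeff hL) ?mulr0 ?mul0rn //.
by rewrite /= mdegD mdeg1 addn1 eqSS mdeg_eq0.
Qed.

(** The multinomial theorem with the denominators cleared.  Induction on the
    degree: a partial derivative lowers the exponent of L by one and takes out
    one coefficient of L. *)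
Lemma mcoeff_linear_exp L m : L \is 1.-homog ->
  (L ^+ mdeg m)@_m *+ (\prod_v (m v)`!)
    = 'X_[m].@[fun v => L@_U_(v)] *+ (mdeg m)`!.
Proof.
move=> hL; move: {2 4}(mdeg m) (erefl (mdeg m)) => d.
elim: d m => [|d IH] m md.
  have /eqP -> : m == 0%MM by rewrite -mdeg_eq0 md.
  rewrite mdeg0 expr0 mpolyX0 mcoeff1 eqxx meval1.
  by rewrite big1 // => v _; rewrite mnm0E.
have [v mv] : exists v, m v != 0%N.
  case: (pickP (fun v => m v != 0%N)) => [v mv|m0]; first by exists v.
  by move: md; rewrite mdegE big1 // => v _; apply/eqP/negbFE/m0.
set m' := (m - U_(v))%MM.
have mE : (m' + U_(v))%MM = m by rewrite /m' submK // lep1mP.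
have md' : mdeg m' = d by move: md; rewrite -mE mdegD mdeg1 addn1 => -[].
have -> : (\prod_w (m w)`! = (m' v).+1 * \prod_w (m' w)`!)%N.
  rewrite (bigD1 v) // [in RHS](bigD1 v) //= mulnA -factS; congr (_ * _)%N.
    by rewrite -mE mnmDE mnm1E eqxx addn1.
  apply: eq_bigr => w wv; rewrite -mE mnmDE mnm1E eq_sym (negPf wv).
  by rewrite addn0.
rewrite -mE mdegD mdeg1 addn1 mulrnA -mcoeff_deriv mderivX_exp mderiv_linear //.
rewrite mcoeffMn mcoeffCM mulrnAC -mulrnAr IH // mpolyXD mevalM mevalXU.
by rewrite mulrnAr -mulrnA factS md' mulnC [X in X *+ _]mulrC.
Qed.

End LinearPowers.

(** * Linear algebra and generic points *)

(** In a linear relation among the f u, pair with psi u for u of maximal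
    degree among the indices that occur: only the coefficient of f u survives.
    Hence the f u are independent vectors of k^s. *)
Lemma leq_card_triangular (k : fieldType) (I : finType) (A : pred I) (s : nat)
    (deg : I -> nat) (f psi : I -> 'I_s -> k) :
    {in A &, forall u w, (deg w <= deg u)%N -> w != u ->
       \sum_p psi u p * f w p = 0} ->
    {in A, forall u, \sum_p psi u p * f u p != 0} ->
  (#|A| <= s)%N.
Proof.
move=> off diag.
pose B := \matrix_(a < #|A|, p < s) f (enum_val a) p.
suff /eqP <- : row_free B by exact: rank_leq_col.
apply/inj_row_free => c cB; apply/rowP => a0; rewrite mxE; apply/eqP.
apply: contraT => ca0; pose D (a : 'I_#|A|) := deg (enum_val a).
have [a ca amax] := @arg_maxnP _ a0 (fun a => c 0 a != 0) D ca0.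
have aA := enum_valP a; case/eqP: ca.
apply: (mulIf (diag _ aA)); rewrite mul0r.
transitivity (\sum_p psi (enum_val a) p * (c *m B) 0 p); last first.
  by rewrite cB big1 // => p _; rewrite mxE mulr0.
under [RHS]eq_bigr do rewrite mxE mulr_sumr.
rewrite exchange_big (bigD1 a) //= [X in _ + X]big1 ?addr0 => [|a' a'a].
  by rewrite mulr_sumr; apply: eq_bigr => p _; rewrite mxE mulrCA.
under eq_bigr do rewrite mxE mulrCA; rewrite -mulr_sumr.
have [->|ca'] := eqVneq (c 0 a') 0; first by rewrite mul0r.
rewrite off ?mulr0 ?enum_valP //; first exact: amax.
by apply: contra a'a => /eqP /enum_val_inj ->.
Qed.

(** Each vector y p <> 0 is the coefficient sequence of a nonzero polynomial;
    take for alpha the powers of a scalar that is a root of none of them. *)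
Lemma exists_generic_combination (k : closedFieldType) (r s : nat)
    (y : 'I_s -> 'I_r -> k) :
  exists alpha : 'I_r -> k,
    forall p, \sum_i alpha i * y p i = 0 -> forall i, y p i = 0.
Proof.
pose q p : {poly k} := \sum_i y p i *: 'X^i.
have /closed_nonrootP [z zP] : \prod_(p | q p != 0) q p != 0.
  by rewrite prodf_seq_neq0; apply/allP => p _; apply/implyP.
exists (fun i : 'I_r => z ^+ i) => p sp i.
have q0 : q p = 0.
  apply: contraNeq zP => qp; rewrite /root horner_prod (bigD1 p) //=.
  rewrite horner_sum (eq_bigr (fun i : 'I_r => z ^+ i * y p i)) => [|j _].
    by rewrite sp mul0r.
  by rewrite !hornerE mulrC.
have := coef0 k i; rewrite -q0 coef_sum (bigD1 i) //= big1 => [|j ji].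
  by rewrite coefZ coefXn eqxx mulr1 addr0.
by rewrite coefZ coefXn eq_sym [_ == _](negPf ji) mulr0.
Qed.

(** * Roots of unity *)

(** 'X^n - 1 is separable and splits, hence has n distinct roots. *)
Lemma prim_root_exists (k : closedFieldType) (n : nat) :
  [pchar k] =i pred0 -> (0 < n)%N -> exists z : k, n.-primitive_root z.
Proof.
move=> char0 n_gt0; pose p : {poly k} := 'X^n - 1.
have [rs] := closed_field_poly_normal p.
have lead_p : lead_coef p = 1 by apply/monicP/monicXnsubC.
rewrite lead_p scale1r => Dp.
have rn1 : all n.-unity_root rs.
  by apply/allP => z; rewrite -root_prod_XsubC -Dp.
have sz_rs : (n < (size rs).+1)%N.
  by rewrite -(size_prod_XsubC rs id) -Dp size_XnsubC.
have [|z] := hasP (has_prim_root n_gt0 rn1 _ sz_rs); last by exists z.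
rewrite -separable_prod_XsubC -Dp separable_Xn_sub_1 //.
by rewrite (pcharf0P k).1 // -lt0n.
Qed.

Lemma sum_prim_root (k : fieldType) (n m : nat) (z : k) :
  n.-primitive_root z ->
  \sum_(j < n) z ^+ (j * m) = if (n %| m)%N then n%:R else 0.
Proof.
move=> zP; under eq_bigr do rewrite mulnC exprM.
case: ifPn => [|nm].
  rewrite (prim_order_dvd zP) => /eqP ->.
  by under eq_bigr do rewrite expr1n; rewrite sumr_const card_ord.
have zm1 : z ^+ m - 1 != 0 by rewrite subr_eq0 -(prim_order_dvd zP).
apply: (mulfI zm1); rewrite -subrX1 mulr0 -exprM mulnC exprM.
by rewrite (prim_expr_order zP) expr1n subrr.
Qed.

(** * Building decompositions *)

Lemma sum_of_powers_sum (k : fieldType) (N d : nat) (I : finType)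
    (F : I -> {mpoly k[N]}) (s : I -> nat) :
  (forall i, sum_of_powers d (F i) (s i)) ->
  sum_of_powers d (\sum_i F i) (\sum_i s i)%N.
Proof.
move=> FP; elim/big_rec2: _ => [|i t G _ [L [L1 ->]]].
  by exists (fun=> 0); split=> [i|]; rewrite ?dhomog0 ?big_ord0.
have [K [K1 ->]] := FP i.
exists (fun j => match split j with inl j => K j | inr j => L j end).
split=> [j|]; first by case: split.
rewrite big_split_ord /=; congr (_ + _); apply: eq_bigr => j _.
  by rewrite (unsplitK (inl j)).
by rewrite (unsplitK (inr j)).
Qed.

(** A scalar is absorbed into the linear form through a d-th root. *)
Lemma sum_of_powers_scaled (k : closedFieldType) (N d : nat) (I : finType)
    (A : pred I) (c : I -> k) (L : I -> {mpoly k[N]}) :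
    (0 < d)%N -> (forall i, L i \is 1.-homog) ->
  sum_of_powers d (\sum_(i in A) c i *: L i ^+ d) #|A|.
Proof.
move=> d_gt0 L1.
have [a aP] : exists a : I -> k, forall i, a i ^+ d = c i.
  apply: (fin_all_exists (P := fun i x => x ^+ d = c i)) => i.
  have [|a] := @closed_rootP k ('X^d - (c i)%:P) _.
    by rewrite size_XnsubC // eqSS -lt0n.
  by rewrite rootE !hornerE subr_eq0 => /eqP; exists a.
exists (fun j => a (enum_val j) *: L (enum_val j)).
split=> [j|]; first exact: dhomogZ.
by rewrite big_enum_val; apply: eq_bigr => j _; rewrite exprZn aP.
Qed.

(** * Sums of coprime monomials *)

Section CoprimeMonomials.

(* The variable v lies in the block b v and has exponent e v; f i plays the
   part of x_{i,1}. *)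
Variables (k : closedFieldType) (N r d : nat).
Hypothesis char0 : [pchar k] =i pred0.
Variables (b : 'I_N -> 'I_r) (e : 'I_N -> nat) (f : 'I_r -> 'I_N).
Hypotheses (bf : forall i, b (f i) = i) (ef_gt0 : forall i, (0 < e (f i))%N).

Definition block_mnm i : 'X_{1..N} :=
  [multinom (if b v == i then e v else 0)%N | v < N].

Definition side_exp i v := if (b v == i) && (v != f i) then e v else 0%N.

Definition monomial_rank i := (\prod_v (side_exp i v).+1)%N.

(** These functions index both the monomials dividing M_i / x_{i,1}^a_{i,1}
    and, as exponents of primitive roots, the tuples of roots of unity.  Their
    values are bounded by the degree d so that they form a family over a single
    finite type. *)
Definition exponents i : pred {ffun 'I_N -> 'I_d.+1} :=
  family (fun v => [pred x : 'I_d.+1 | (x < (side_exp i v).+1)%N]).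

Hypothesis deg_block : forall i, mdeg (block_mnm i) = d.

Let natr_neq0 m : (0 < m)%N -> m%:R != 0 :> k.
Proof. by move=> m0; rewrite (pcharf0P k).1 // -lt0n. Qed.

Let fact_neq0 m : (m`!)%:R != 0 :> k.
Proof. by rewrite natr_neq0 ?fact_gt0. Qed.

Let prod_fact_neq0 (m : 'X_{1..N}) : (\prod_v (m v)`!)%:R != 0 :> k.
Proof. by rewrite natr_neq0 // prodn_gt0 // => v; rewrite fact_gt0. Qed.

Let block_mnmE i v : block_mnm i v = if b v == i then e v else 0%N.
Proof. exact: mnmE. Qed.

Let block_mnm_f i j : block_mnm i (f j) = if j == i then e (f j) else 0%N.
Proof. by rewrite block_mnmE bf. Qed.

Let le_side_exp i v : (side_exp i v <= block_mnm i v)%N.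
Proof. by rewrite block_mnmE /side_exp; case: (b v == i); case: (v != _). Qed.

Let side_exp_le i v : (side_exp i v <= d)%N.
Proof.
rewrite (leq_trans (le_side_exp i v)) // -(deg_block i) mdegE.
by rewrite (bigD1 v) //= leq_addr.
Qed.

Lemma card_exponents i : #|exponents i| = monomial_rank i.
Proof.
rewrite card_family foldrE big_map big_enum; apply: eq_bigr => v _.
rewrite -[RHS]card_ord -sum1_card -[RHS]sum1_card.
by rewrite (big_ord_widen d.+1 (fun=> 1%N)) ?ltnS.
Qed.

Let block_of_divisor m i j : (0 < mdeg m)%N ->
  (m <= block_mnm i)%MM -> (m <= block_mnm j)%MM -> i = j.
Proof.
rewrite lt0n mdegE sum_nat_eq0 negb_forall => /existsP [v /= mv].
move=> /mnm_lepP/(_ v) hi /mnm_lepP/(_ v); move: hi; rewrite !block_mnmE.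
case: eqP => [<- _|_]; last by rewrite leqn0 (negPf mv).
by case: eqP => // _; rewrite leqn0 (negPf mv).
Qed.

Lemma mcoeff_sum_blocks_neq0 j :
  (\sum_i 'X_[block_mnm i] : {mpoly k[N]})@_(block_mnm j) != 0.
Proof.
rewrite linear_sum (bigD1 j) //= mcoeffX eqxx.
under eq_bigr do rewrite mcoeffX.
by rewrite -natr_sum -natrD natr_neq0.
Qed.

(** ** Lower bound *)

Section LowerBound.
Variables (s : nat) (L : 'I_s -> {mpoly k[N]}).
Hypotheses (d_ge2 : (2 <= d)%N) (L1 : forall p, L p \is 1.-homog)
  (eqF : \sum_i 'X_[block_mnm i] = \sum_p L p ^+ d).

Let x p v := (L p)@_U_(v).

Let moment m : mdeg m = d ->
  (\sum_p 'X_[m].@[x p]) *+ d`!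
    = (\sum_i 'X_[block_mnm i] : {mpoly k[N]})@_m *+ (\prod_v (m v)`!).
Proof.
move=> md; rewrite -sumrMnl -md.
rewrite (eq_bigr _ (fun p _ => esym (mcoeff_linear_exp m (L1 p)))).
by rewrite sumrMnl -linear_sum md -eqF.
Qed.

Let moment0 m : mdeg m = d -> (forall i, m != block_mnm i) ->
  \sum_p 'X_[m].@[x p] = 0.
Proof.
move=> md mi; apply: (mulIf (fact_neq0 d)); rewrite mulr_natr moment // mul0r.
rewrite linear_sum big1 ?mul0rn // => i _.
by rewrite /= mcoeffX eq_sym (negPf (mi i)).
Qed.

Let moment_neq0 i : \sum_p 'X_[block_mnm i].@[x p] != 0.
Proof.
apply/eqP => h; have /esym/eqP := moment (deg_block i).
rewrite h mul0rn -mulr_natr mulf_eq0 (negPf (prod_fact_neq0 _)) orbF.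
by apply/negP; exact: mcoeff_sum_blocks_neq0.
Qed.

Section Pairing.
Variable alpha : 'I_r -> k.
Let t p := \sum_i alpha i * x p (f i).

Let moment_tS m q :
  \sum_p 'X_[m].@[x p] * t p ^+ q.+1
    = \sum_j alpha j * \sum_p 'X_[m + U_(f j)].@[x p] * t p ^+ q.
Proof.
under [RHS]eq_bigr do rewrite mulr_sumr.
rewrite exchange_big; apply: eq_bigr => p _ /=.
rewrite exprS mulrCA /t mulr_suml; apply: eq_bigr => j _.
by rewrite mpolyXD mevalM mevalXU -!mulrA; congr (_ * _); rewrite mulrCA.
Qed.

(* Multiplication by t only enlarges the monomials, so once outside all
   divisors of the blocks they stay outside. *)
Let moment_t0 m q : (mdeg m + q)%N = d ->
  (forall i, ~~ (m <= block_mnm i)%MM) -> \sum_p 'X_[m].@[x p] * t p ^+ q = 0.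
Proof.
elim: q m => [|q IH] m md mi.
  under eq_bigr do rewrite expr0 mulr1.
  rewrite moment0 -?md ?addn0 // => i; apply: contra (mi i) => /eqP <-.
  exact: lepm_refl.
rewrite moment_tS big1 // => j _; rewrite IH ?mulr0 //.
  by rewrite mdegD mdeg1 -addnA.
by move=> i; apply: contra (mi i); apply: lepm_trans; exact: lem_addr.
Qed.

Hypothesis alphaP : forall p, t p = 0 -> forall i, x p (f i) = 0.

Let index := ('I_r * {ffun 'I_N -> 'I_d.+1})%type.
Let A := [pred u : index | u.2 \in exponents u.1].

(* The exponent function 0 stands for f i itself, so that all these monomials
   have positive degree and deg - 1 never truncates. *)
Let test_mnm (u : index) : 'X_{1..N} :=
  let m := [multinom (u.2 v : nat) | v < N] in
  if m == 0%MM then U_(f u.1)%MM else m.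

Let cofactor u := (block_mnm u.1 - test_mnm u)%MM.

Let test_mnm_gt0 u : (0 < mdeg (test_mnm u))%N.
Proof.
rewrite /test_mnm; case: ifPn => [_|]; first by rewrite mdeg1.
by rewrite lt0n mdeg_eq0.
Qed.

Let exponents_f i (u : {ffun 'I_N -> 'I_d.+1}) j :
  u \in exponents i -> u (f j) = 0 :> nat.
Proof.
move=> /familyP /(_ (f j)); rewrite inE ltnS /side_exp bf.
by have [->|_] := eqVneq j i; rewrite ?eqxx /= leqn0 => /eqP.
Qed.

Let test_mnm_le u : u \in A -> (test_mnm u <= block_mnm u.1)%MM.
Proof.
move=> uA; rewrite /test_mnm; case: ifP => _.
  by rewrite lep1mP block_mnm_f eqxx -lt0n.
apply/mnm_lepP => v; rewrite mnmE; apply: leq_trans (le_side_exp _ _).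
by have /familyP/(_ v) := uA.
Qed.

Let cofactorK u : u \in A -> (cofactor u + test_mnm u)%MM = block_mnm u.1.
Proof. by move=> uA; rewrite submK // test_mnm_le. Qed.

Let cofactor_f u : u \in A -> (1 < mdeg (test_mnm u))%N ->
  cofactor u (f u.1) = e (f u.1).
Proof.
move=> uA; rewrite /cofactor mnmBE block_mnm_f eqxx /test_mnm; case: ifP => _.
  by rewrite mdeg1.
by rewrite mnmE (exponents_f _ uA) subn0.
Qed.

Let test_mnm_inj : {in A &, forall u w,
  u.1 = w.1 -> test_mnm u = test_mnm w -> u = w}.
Proof.
move=> [i u] [i' w] uA wA /= ii'; rewrite -{i'}ii' in wA *.
set mu := [multinom (u v : nat) | v < N].
set mw := [multinom (w v : nat) | v < N].
have neq (z : {ffun 'I_N -> 'I_d.+1}) : z \in exponents i ->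
    U_(f i)%MM <> [multinom (z v : nat) | v < N].
  move=> zA /mnmP/(_ (f i)); rewrite mnm1E eqxx mnmE.
  by rewrite (exponents_f _ zA).
suff uw : test_mnm (i, u) = test_mnm (i, w) -> mu = mw.
  move=> /uw/mnmP {}uw; congr (_, _); apply/ffunP => v; apply/val_inj.
  by have := uw v; rewrite !mnmE.
rewrite /test_mnm /= -/mu -/mw; case: eqP => [->|_]; case: eqP => [->|_] //.
  by move/(neq _ wA).
by move/esym/(neq _ uA).
Qed.

Let cofactor_f_gt0 u : u \in A -> (1 < mdeg (test_mnm u))%N ->
  (0 < cofactor u (f u.1))%N.
Proof. by move=> uA u1; rewrite cofactor_f. Qed.

Let test_fun u p :=
  'X_[test_mnm u].@[x p] * t p ^- (mdeg (test_mnm u)).-1.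
Let dual_of u p :=
  'X_[cofactor u].@[x p] * t p ^+ (mdeg (test_mnm u)).-1.

(* The only issue is a zero of t.  There all the f i vanish by the choice of
   alpha, hence so do both sides if test_mnm u has degree at least 2, as the
   cofactor then contains f u.1; in degree 1 no power of t is left. *)
Let dual_fun u w p : u \in A -> (mdeg (test_mnm w) <= mdeg (test_mnm u))%N ->
  dual_of u p * test_fun w p = 'X_[cofactor u + test_mnm w].@[x p]
    * t p ^+ (mdeg (test_mnm u) - mdeg (test_mnm w)).
Proof.
move=> uA wu; rewrite mulrACA -mevalM -mpolyXD.
have [tp|tp] := eqVneq (t p) 0; last first.
  rewrite -exprB ?unitfE // -!subn1 ?leq_sub2r //.
  by rewrite subnBA // subnK.
have [u1|u1] := leqP (mdeg (test_mnm u)) 1.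
  have -> : mdeg (test_mnm u) = 1%N.
    by apply/eqP; rewrite eqn_leq u1 test_mnm_gt0.
  have -> : mdeg (test_mnm w) = 1%N.
    by apply/eqP; rewrite eqn_leq (leq_trans wu u1) test_mnm_gt0.
  by rewrite !expr0 invr1 mulr1.
suff -> : 'X_[cofactor u + test_mnm w].@[x p] = 0 by rewrite !mul0r.
rewrite mpolyXD mevalM mevalX (bigD1 (f u.1)) //= (alphaP tp) expr0n.
by rewrite eqn0Ngt cofactor_f_gt0 // !mul0r.
Qed.

Let dual_fun_off : {in A &, forall u w,
  (mdeg (test_mnm w) <= mdeg (test_mnm u))%N -> w != u ->
  \sum_p dual_of u p * test_fun w p = 0}.
Proof.
move=> u w uA wA wu neq_wu; under eq_bigr do rewrite dual_fun //.
have degC : (mdeg (cofactor u) + mdeg (test_mnm u))%N = d.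
  by rewrite -mdegD cofactorK.
(* The cofactor forces the block u.1 and already has the full exponent of
   f u.1, so a further variable f j, which can only be f u.1, is too many. *)
have low i j : (1 < mdeg (test_mnm u))%N ->
    ~~ (cofactor u + test_mnm w + U_(f j) <= block_mnm i)%MM.
  move=> u1; apply/negP => /mnm_lepP le.
  have := le (f u.1); rewrite !mnmDE block_mnm_f.
  case: eqP => [iu|_]; last first.
    by rewrite leqn0 !addn_eq0 eqn0Ngt cofactor_f_gt0.
  have := le (f j); rewrite !mnmDE block_mnm_f mnm1E eqxx addn1 -iu.
  by case: eqP => [->|//]; rewrite cofactor_f // ltnNge leq_addr.
have [eq_deg|lt_deg] : (mdeg (test_mnm w) = mdeg (test_mnm u)) \/
    (mdeg (test_mnm w) < mdeg (test_mnm u))%N.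
  by move: wu; rewrite leq_eqVlt => /orP[/eqP|]; [left|right].
- rewrite eq_deg subnn; under eq_bigr do rewrite expr0 mulr1.
  apply: moment0 => [|i]; first by rewrite mdegD eq_deg.
  apply: contra neq_wu => /eqP Ei; apply/eqP.
  have iw : i = w.1.
    by apply: block_of_divisor (test_mnm_le wA); rewrite -?Ei ?lem_addl.
  have iu : i = u.1.
    apply: (@block_of_divisor (cofactor u)); rewrite -?Ei ?lem_addr //.
      have [u1|/(cofactor_f_gt0 uA) h] := leqP (mdeg (test_mnm u)) 1.
        rewrite -(ltn_add2r (mdeg (test_mnm u))) degC add0n.
        exact: leq_ltn_trans d_ge2.
      by rewrite mdegE (bigD1 (f u.1)) //= ltn_addr.
    by rewrite -(cofactorK uA) lem_addr.
  apply: test_mnm_inj; rewrite -?iw -?iu //.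
  move: Ei; rewrite iu -(cofactorK uA); exact: addmI.
rewrite -(subnSK lt_deg) moment_tS big1 // => j _; rewrite moment_t0 ?mulr0 //.
  by move: lt_deg degC; rewrite mdegD mdegD mdeg1; lia.
by move=> i; apply: low; apply: leq_ltn_trans lt_deg; exact: test_mnm_gt0.
Qed.

Lemma sum_monomial_rank_le_generic : (\sum_i monomial_rank i <= s)%N.
Proof.
under eq_bigr do rewrite -card_exponents -sum1_card.
rewrite pair_big_dep sum1_card; change (#|A| <= s)%N.
apply: leq_card_triangular dual_fun_off _ => u uA.
under eq_bigr do rewrite dual_fun // subnn expr0 mulr1 cofactorK //.
exact: moment_neq0.
Qed.
End Pairing.

Lemma sum_monomial_rank_le : (\sum_i monomial_rank i <= s)%N.
Proof.
have [alpha alphaP] := exists_generic_combination (fun p i => x p (f i)).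
exact: sum_monomial_rank_le_generic alphaP.
Qed.
End LowerBound.

(** ** Upper bound *)

Section UpperBound.
Variable i : 'I_r.
Hypotheses (d_gt0 : (0 < d)%N)
  (f_min : forall v, b v = i -> (e (f i) <= e v)%N).

(* By congruence an exponent that exceeds e v is at least 2 (e v) + 1, which
   takes more from the degree than f i can give back. *)
Let block_mnm_unique (m : 'X_{1..N}) :
    mdeg m = d -> (forall v, b v != i -> m v = 0%N) ->
    (forall v, ((side_exp i v).+1 %| (m v).+1)%N) ->
  m = block_mnm i.
Proof.
move=> md m0 m_dvd.
have le_m v : (side_exp i v <= m v)%N by have := dvdn_leq (ltn0Sn _) (m_dvd v).
have eq_m v : v != f i -> m v = block_mnm i v.
  move=> vf; rewrite block_mnmE; case: eqP => [bv|/eqP]; last exact: m0.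
  have cv : side_exp i v = e v by rewrite /side_exp bv eqxx vf.
  apply/eqP; rewrite eqn_leq -{2}cv le_m andbT leqNgt; apply/negP => lt_v.
  have big_v : (e v + e (f i) < m v)%N.
    have := m_dvd v; rewrite cv => /dvdnP [[|[|q]] mq]; first by [].
      by move: lt_v; rewrite -ltnS mq mul1n ltnn.
    by have := f_min bv; move: mq; lia.
  suff : (d < mdeg m)%N by rewrite md ltnn.
  rewrite -(deg_block i) !mdegE (bigD1 v) //= [X in (_ < X)%N](bigD1 v) //=.
  rewrite (bigD1 (f i)) 1?eq_sym //= addnA -addSn block_mnm_f eqxx.
  rewrite block_mnmE bv eqxx leq_add //.
  rewrite [X in (_ <= X)%N](bigD1 (f i)) 1?eq_sym //=.
  apply: leq_trans (leq_addl _ _); apply: leq_sum => w /andP[_ wf].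
  by apply: leq_trans (le_m w); rewrite block_mnmE /side_exp wf andbT.
apply/mnmP => v; have [->|/eq_m //] := eqVneq v (f i).
have : mdeg m = mdeg (block_mnm i) by rewrite md.
rewrite !mdegE (bigD1 (f i)) //= [RHS](bigD1 (f i)) //= => /eqP.
by rewrite (eq_bigr _ eq_m) eqn_add2r => /eqP.
Qed.

Lemma sum_of_powers_monomial :
  sum_of_powers d ('X_[block_mnm i] : {mpoly k[N]}) (monomial_rank i).
Proof.
pose P v (y : k) := (side_exp i v).+1.-primitive_root y.
have [z zP] : exists z : 'I_N -> k, forall v, P v (z v).
  by apply: (fin_all_exists (P := P)) => v; exact: prim_root_exists.
(* At f i and outside the block z v = 1, since side_exp is 0 there: f i always
   has coefficient 1 in L u, and the other blocks are absent. *)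
pose c (u : {ffun 'I_N -> 'I_d.+1}) v := z v ^+ u v *+ (b v == i).
pose L u : {mpoly k[N]} := \sum_v c u v *: 'X_v.
have L1 u : L u \is 1.-homog.
  by apply: rpred_sum => v _; apply: dhomogZ; rewrite dhomogX /= mdeg1.
have LE u v : (L u)@_U_(v) = c u v.
  rewrite linear_sum (bigD1 v) //= big1 => [|w wv].
    by rewrite mcoeffZ mcoeffXU eqxx mulr1 addr0.
  by rewrite mcoeffZ mcoeffXU (negPf wv) mulr0.
pose wt (u : {ffun 'I_N -> 'I_d.+1}) := \prod_v z v ^+ u v.
pose G : {mpoly k[N]} := \sum_(u in exponents i) wt u *: L u ^+ d.
(* The sum over the tuples of roots of unity factors over the variables. *)
have G_coef m : mdeg m = d -> G@_m *+ (\prod_v (m v)`!) =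
    (\prod_v ((b v == i)%:R ^+ m v
       * (if ((side_exp i v).+1 %| (m v).+1)%N
          then (side_exp i v).+1%:R else 0))) *+ d`!.
  move=> md; rewrite linear_sum /= -sumrMnl.
  transitivity ((\sum_(u in exponents i)
      \prod_v ((b v == i)%:R ^+ m v * z v ^+ (u v * (m v).+1))) *+ d`!).
    rewrite -sumrMnl; apply: eq_bigr => u _.
    rewrite mcoeffZ -mulrnAr; have := mcoeff_linear_exp m (L1 u).
    rewrite md => ->; rewrite mulrnAr; congr (_ *+ _).
    rewrite mevalX -big_split; apply: eq_bigr => v _ /=.
    rewrite LE /c -mulr_natl exprMn mulrCA; congr (_ * _).
    by rewrite -exprM -exprD mulnS.
  congr (_ *+ _); rewrite -(bigA_distr_big_dep
    (fun v (j : 'I_d.+1) => (j < (side_exp i v).+1)%N)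
    (fun v (j : 'I_d.+1) => (b v == i)%:R ^+ m v * z v ^+ (j * (m v).+1))).
  apply: eq_bigr => v _; rewrite -mulr_sumr; congr (_ * _).
  rewrite -(sum_prim_root _ (zP v)).
  by rewrite (big_ord_widen d.+1 (fun j => z v ^+ (j * (m v).+1))) ?ltnS.
have G1 : G \is d.-homog.
  apply: rpred_sum => u _; apply: dhomogZ.
  by have := dhomogMn d (L1 u); rewrite mul1n.
have Gi : G@_(block_mnm i) != 0.
  apply/eqP => G0; have /esym/eqP := G_coef _ (deg_block i).
  rewrite G0 mul0rn -mulr_natr mulf_eq0 (negPf (fact_neq0 _)) orbF.
  apply/negP; rewrite prodf_seq_neq0; apply/allP => v _ /=.
  rewrite mulf_neq0 //.
    rewrite block_mnmE; case: (b v == i); last by rewrite expr0 oner_neq0.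
    by rewrite expr1n oner_neq0.
  suff -> : ((side_exp i v).+1 %| (block_mnm i v).+1)%N by exact: natr_neq0.
  rewrite block_mnmE /side_exp; case: (b v == i); last exact: dvd1n.
  by case: (v != f i); rewrite ?dvd1n.
have -> : 'X_[block_mnm i] = (G@_(block_mnm i))^-1 *: G.
  apply/mpolyP => m; rewrite mcoeffZ mcoeffX.
  have [<-|neq] := eqVneq; first by rewrite mulVf.
  have [md|md] := eqVneq (mdeg m) d; last first.
    by rewrite (dhomog_nemf_coeff G1 md) mulr0.
  suff -> : G@_m = 0 by rewrite mulr0.
  apply: (mulIf (prod_fact_neq0 m)); rewrite mul0r mulr_natr G_coef //.
  apply/eqP; rewrite -mulr_natr mulf_eq0 (negPf (fact_neq0 _)) orbF.
  apply: contraNT neq; rewrite prodf_seq_neq0 => /allP h.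
  rewrite eq_sym; apply/eqP/block_mnm_unique => // v => [bv|].
    have := h v (mem_index_enum _); rewrite mulf_eq0 negb_or => /andP[].
    by rewrite (negPf bv) expr0n; case: (m v) => //= q; rewrite eqxx.
  have := h v (mem_index_enum _); rewrite mulf_eq0 negb_or => /andP[_].
  by case: ifP; rewrite ?eqxx.
rewrite scaler_sumr -card_exponents; under eq_bigr do rewrite scalerA.
exact: sum_of_powers_scaled.
Qed.
End UpperBound.
End CoprimeMonomials.

(** * The rank of the sum *)

Section BlockMonomials.
Variables (k : fieldType) (r : nat) (n : 'I_r -> nat).
Variable a : forall i : 'I_r, 'I_(n i) -> nat.
Arguments a : clear implicits.

Definition block_exp (v : 'I_(\sum_(i < r) n i)) :=
  a (tagnat.sig1 v) (tagnat.sig2 v).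

Lemma block_exp_Rank i (j : 'I_(n i)) : block_exp (tagnat.Rank i j) = a i j.
Proof.
by rewrite /block_exp /tagnat.sig2 /tagnat.sig1 /tagnat.Rank tagnat.rankK.
Qed.

Lemma block_mnm_sum i :
  block_mnm tagnat.sig1 block_exp i
    = (\sum_(j < n i) U_(tagnat.Rank i j) *+ a i j)%MM.
Proof.
apply/mnmP => v; rewrite mnmE mnm_sumE -(tagnat.sig2K v).
move: (tagnat.sig1 v) (tagnat.sig2 v) => i' j'.
rewrite tagnat.Rank1K block_exp_Rank.
have [Ei|ii'] := eqVneq; last first.
  rewrite big1 // => j _; rewrite mulmnE mnm1E; case: eqP => // E.
  by move: ii'; rewrite -(tagnat.Rank1K j') -E tagnat.Rank1K eqxx.
case: _ / Ei; rewrite (bigD1 j') //= mulmnE mnm1E eqxx mul1n.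
rewrite [X in (_ + X)%N]big1 ?addn0 // => j jj'.
rewrite mulmnE mnm1E; case: eqP => // /tagnat.rank_inj /eqP.
by rewrite eq_Tagged /= (negPf jj').
Qed.

Lemma mdeg_block_mnm i :
  mdeg (block_mnm tagnat.sig1 block_exp i) = (\sum_(j < n i) a i j)%N.
Proof.
rewrite block_mnm_sum mdeg_sum; apply: eq_bigr => j _.
by rewrite mdegMn mdeg1 mul1n.
Qed.

Lemma block_monomialE i :
  block_monomial k a i = 'X_[block_mnm tagnat.sig1 block_exp i].
Proof. by rewrite block_mnm_sum /block_monomial /blockX mprodXnE. Qed.
End BlockMonomials.

Theorem theorem3p2 (k : closedFieldType) (char0 : [pchar k] =i pred0)
    (r : nat) (r_gt0 : (1 <= r)%N)
    (n : 'I_r -> nat) (n_gt0 : forall i, (1 <= n i)%N)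
    (d : nat) (a : forall i : 'I_r, 'I_(n i) -> nat)
    (a_sum : forall i, (\sum_(j < n i) a i j)%N = d)
    (a_gt0 : forall i j, (1 <= a i j)%N)
    (a_sorted : forall i (j1 j2 : 'I_(n i)),
        (j1 <= j2)%N -> (a i j1 <= a i j2)%N) :
  let M : 'I_r -> {mpoly k[\sum_(i < r) n i]} := block_monomial k a in
  let F := \sum_(i < r) M i in
  (d = 1%N -> waring_rank d F = 1%N) /\
  ((2 <= d)%N -> waring_rank d F = (\sum_(i < r) waring_rank d (M i))%N).
Proof.
move=> M F; set N := (\sum_(i < r) n i)%N in M F *.
pose b : 'I_N -> 'I_r := tagnat.sig1; pose e : 'I_N -> nat := block_exp a.
pose f i : 'I_N := tagnat.Rank i (Ordinal (n_gt0 i)).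
have bf i : b (f i) = i by exact: tagnat.Rank1K.
have ef i : e (f i) = a i (Ordinal (n_gt0 i)) by exact: block_exp_Rank.
have ef_gt0 i : (0 < e (f i))%N by rewrite ef.
have deg_b i : mdeg (block_mnm b e i) = d by rewrite mdeg_block_mnm.
have ME i : M i = 'X_[block_mnm b e i] by exact: block_monomialE.
have FE : F = \sum_i 'X_[block_mnm b e i] by apply: eq_bigr => i _.
have M_homog i : M i \is d.-homog by rewrite ME dhomogX /= deg_b.
have F_homog : F \is d.-homog by apply: rpred_sum.
split=> [d1|d_ge2].
  have d_gt0 : (0 < d)%N by rewrite d1.
  have [[L [_ FL]] min_rank] := waring_rankP char0 d_gt0 F_homog.
  apply/eqP; rewrite eqn_leq; apply/andP; split.
    apply: min_rank; exists (fun=> F); split=> [_|]; first by rewrite -d1.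
    by rewrite big_ord1 d1 expr1.
  rewrite lt0n; apply: contraTneq isT => rk0.
  have := mcoeff_sum_blocks_neq0 char0 b e (Ordinal r_gt0).
  rewrite -FE FL big1 ?mcoeff0 ?eqxx // => -[p p_lt].
  by exfalso; rewrite rk0 in p_lt.
have d_gt0 : (0 < d)%N := ltnW d_ge2.
have [FP min_F] := waring_rankP char0 d_gt0 F_homog.
apply/eqP; rewrite eqn_leq; apply/andP; split.
  apply: min_F; apply: sum_of_powers_sum => i.
  by have [] := waring_rankP char0 d_gt0 (M_homog i).
apply: (@leq_trans (\sum_i monomial_rank b e f i)); last first.
  have [L [L1 /(etrans (esym FE)) FL]] := FP.
  exact: (sum_monomial_rank_le char0 bf ef_gt0 deg_b d_ge2 L1 FL).
apply: leq_sum => i _.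
have [_ min_M] := waring_rankP char0 d_gt0 (M_homog i).
apply: min_M; rewrite ME; apply: (sum_of_powers_monomial char0) => // v <-.
rewrite ef; exact: a_sorted.
Qed.
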